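(* Let $Y$ be a real topological vector space, $F\subseteq Y$, let $H$ be a proper closed subset of $Y$ and $k\in 0^+H\setminus\{0\}$. If $\Lambda\subset Y$ with $Y=\{\lambda+\beta k\mid\lambda\in\Lambda,\ \beta\in\mathbb{R}\}$, then $$\bigcup_{a\in Y}M_{F,a,H,k}=\bigcup_{a\in\Lambda}M_{F,a,H,k}.$$
   Context: For $A\subseteq Y$, the recession cone is $0^+A:=\{u\in Y\mid A+\mathbb{R}_+u\subseteq A\}$, where $\mathbb{R}_+=[0,\infty)$. A proper subset of $Y$ is a nonempty subset different from $Y$. For $a\in Y$, $(P_{F,a,H,k})$ is the problem of minimizing $t$ over all pairs $(y,t)\in F\times\mathbb{R}$ with $y\in a-H+tk$ (the feasible solutions). $M_{F,a,H,k}$ is the set of its optimal solutions $y$, i.e. of all $y\in F$ for which there is $t\in\mathbb{R}$ such that $(y,t)$ is feasible and $t\le s$ for every feasible $(z,s)$. *)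

(* Defs.v *)
From HB Require Import structures.
From mathcomp Require Import all_boot all_order all_algebra.
From mathcomp Require Import all_classical all_reals all_analysis.

Set Implicit Arguments.
Unset Strict Implicit.
Unset Printing Implicit Defensive.

Import Order.TTheory GRing.Theory Num.Theory.
Import numFieldNormedType.Exports.

Local Open Scope classical_set_scope.
Local Open Scope ring_scope.

Definition recession_cone (R : realType) (Y : lmodType R) (A : set Y) : set Y :=
  [set u | [set x + r *: u | x in A & r in [set r : R | 0 <= r]] `<=` A].

(* Nonemptiness is part of the notion: set0 is not a proper subset here. *)
Definition proper_subset (Y : Type) (A : set Y) : Prop :=
  A !=set0 /\ A <> [set: Y].

(* The Minkowski set a - H + t k is spelled out as an image of H. *)
Definition feasible (R : realType) (Y : lmodType R) (F : set Y) (a : Y)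
    (H : set Y) (k : Y) : set (Y * R) :=
  [set yt | F yt.1 /\ [set a - h + yt.2 *: k | h in H] yt.1].

(* The set M_{F,a,H,k}: it collects the Y-components of optimal pairs (y, t). *)
Definition optimal_solutions (R : realType) (Y : lmodType R) (F : set Y) (a : Y)
    (H : set Y) (k : Y) : set Y :=
  [set y | F y /\ exists t : R, feasible F a H k (y, t) /\
     forall (z : Y) (s : R), feasible F a H k (z, s) -> t <= s].

(* Main.v *)
(** Replacing [a] by [a + b k] only translates the parameter [t] by [b], so the
    set of optimal solutions is constant along each line [a + R k], and every
    such line meets [Lambda]. *)

Require Import Defs.
From HB Require Import structures.
From mathcomp Require Import all_boot all_order all_algebra.
From mathcomp Require Import all_classical all_reals all_analysis.

Import Order.TTheory GRing.Theory Num.Theory.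
Import numFieldNormedType.Exports.

Local Open Scope classical_set_scope.
Local Open Scope ring_scope.

(** Since [(a + b k) - h + t k = a - h + (b + t) k], moving [a] along [k] keeps each feasible [y]
    and only reparametrizes [t] ([feasible_shift]). Translations of the real line preserve order,
    hence minimality ([optimal_solutions_shift]), so any [a] may be replaced by a point of [Lambda]
    on its line. *)

Lemma feasible_shift (R : realType) (Y : lmodType R) (F H : set Y) (a k : Y)
    (b : R) (y : Y) (t : R) :
  feasible F (a + b *: k) H k (y, t) <-> feasible F a H k (y, b + t).
Proof.
have shiftE h : a + b *: k - h + t *: k = a - h + (b + t) *: k.
  by rewrite scalerDl addrA (addrAC a).
by split=> -[Fy [h Hh /= hy]]; split=> //; exists h; rewrite //= -hy shiftE.
Qed.

Lemma optimal_solutions_shift (R : realType) (Y : lmodType R) (F H : set Y)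
    (a k : Y) (b : R) :
  optimal_solutions F (a + b *: k) H k = optimal_solutions F a H k.
Proof.
apply/seteqP; split=> y [Fy [t [yt t_min]]]; split=> //.
  (* The optimal value for [a] is [b] more than that for [a + b k]; a competitor [(z, s)] for [a]
     becomes [(z, s - b)]. *)
  exists (b + t); split; first exact/feasible_shift.
  move=> z s zs; rewrite -lerBrDl; apply: (t_min z).
  by apply/feasible_shift; rewrite subrKC.
(* Conversely, a competitor [(z, s)] for [a + b k] becomes [(z, b + s)] for [a]. *)
exists (t - b); split; first by apply/feasible_shift; rewrite subrKC.
by move=> z s /feasible_shift /t_min; rewrite lerBlDl.
Qed.

Theorem proposition14 (R : realType) (Y : topologicalLmodType R)
    (F H Lambda : set Y) (k : Y)
    (H_proper : proper_subset H)
    (H_closed : closed H)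
    (k_rec : (recession_cone H `\ 0) k)
    (Lambda_k : [set: Y] = [set l + b *: k | l in Lambda & b in [set: R]]) :
  \bigcup_(a in [set: Y]) optimal_solutions F a H k =
  \bigcup_(a in Lambda) optimal_solutions F a H k.
Proof.
apply/seteqP; split=> [y [a _ ya]|]; last exact: bigcup_subset.
have : [set: Y] a by [].
rewrite Lambda_k => -[l Ll [b _ lba]].
by exists l => //; move: ya; rewrite -lba optimal_solutions_shift.
Qed.
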